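(* Let $r\ge 3$ be an integer and let $k$ be a positive integer that is a multiple of $r-1$. Then $$\chi_l(K_{2r,r*(k-1)}^r)>\chi(K_{2r,r*(k-1)}^r)=k.$$
   Context: All hypergraphs are finite. An $r$-uniform hypergraph has all edges of size $r$. A vertex coloring of a hypergraph is proper if no edge is monochromatic (every edge contains two vertices of different colors). $\chi(H)$ is the chromatic number. A $k$-list assignment $L$ assigns to each vertex $v$ a set $L(v)$ of exactly $k$ colors; an $L$-coloring is a proper coloring with each vertex $v$ colored from $L(v)$; $H$ is $k$-choosable if it is $L$-colorable for every $k$-list assignment $L$, and $\chi_l(H)$ is the least such $k$. For positive integers $p_1,\dots,p_k$ and disjoint sets $V_1,\dots,V_k$ with $|V_i|=p_i$, the $r$-complete $k$-partite hypergraph $K^r_{p_1,\dots,p_k}$ has vertex set $V_1\cup\cdots\cup V_k$ and edge set consisting of all $r$-subsets $S$ of the vertex set with $S\not\subseteq V_i$ for every $i$. The notation $K^r_{p*s,p_{s+1},\dots}$ means that $s$ parts have size $p$; thus $K_{2r,r*(k-1)}^r$ has one part of size $2r$ and $k-1$ parts of size $r$. *)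

(* Defs.v *)
From HB Require Import structures.
From mathcomp Require Import all_boot.
From mathcomp Require Import finmap.
From mathcomp Require Import boolp.
Set Implicit Arguments.
Unset Strict Implicit.
Unset Printing Implicit Defensive.

(* A hypergraph on a finite vertex type [V] is its edge set [H : {set {set V}}]. *)

Definition proper (V : finType) (H : {set {set V}}) (C : eqType) (c : V -> C) : Prop :=
  forall e : {set V}, e \in H -> exists u v, [/\ u \in e, v \in e & c u != c v].

Definition colorable (V : finType) (H : {set {set V}}) (k : nat) : Prop :=
  exists c : V -> 'I_k, proper H c.

Definition list_assignment (V : finType) (C : choiceType) (k : nat)
    (L : V -> {fset C}) : Prop :=
  forall v, #|` L v| = k.

Definition list_colorable (V : finType) (H : {set {set V}}) (C : choiceType)
    (L : V -> {fset C}) : Prop :=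
  exists2 c : V -> C, proper H c & forall v, c v \in L v.

Definition choosable (V : finType) (H : {set {set V}}) (k : nat) : Prop :=
  forall (C : choiceType) (L : V -> {fset C}),
    list_assignment k L -> list_colorable H L.

(* The least [n] satisfying [P]; the value is 0 when there is none. *)
Definition least (P : nat -> Prop) : nat :=
  if pselect (exists n, `[< P n >]) is left exP then ex_minn exP else 0.

Lemma leastP (P : nat -> Prop) :
  (exists n, P n) -> P (least P) /\ forall m, P m -> least P <= m.
Proof.
move=> [n Pn]; rewrite /least; case: pselect => [exP|[]]; last first.
  by exists n; apply/asboolP.
case: ex_minnP => m /asboolP Pm le_m; split=> // j Pj.
by apply: le_m; apply/asboolP.
Qed.

Definition chromatic_number (V : finType) (H : {set {set V}}) : nat :=
  least (colorable H).

Definition choice_number (V : finType) (H : {set {set V}}) : nat :=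
  least (choosable H).

(* The minima above are attained as soon as every edge has at least two
   vertices, so the default value of [least] plays no role for r-uniform
   hypergraphs with r >= 2. *)
Lemma inj_proper (V : finType) (H : {set {set V}}) (C : eqType) (c : V -> C) :
  (forall e, e \in H -> 1 < #|e|) -> injective c -> proper H c.
Proof.
move=> H_gt1 c_inj e /H_gt1 /card_gt1P[u [v [ue ve uv]]].
by exists u, v; rewrite (inj_eq c_inj).
Qed.

Lemma colorable_card (V : finType) (H : {set {set V}}) :
  (forall e, e \in H -> 1 < #|e|) -> colorable H #|V|.
Proof. by move=> H_gt1; exists enum_rank; apply: inj_proper enum_rank_inj. Qed.

Lemma choosable_card (V : finType) (H : {set {set V}}) :
  (forall e, e \in H -> 1 < #|e|) -> choosable H #|V|.
Proof.
move=> H_gt1 C L L_k.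
have [c c_inj cL]: exists2 c : V -> option C,
    {in enum V &, injective c} &
    forall v, v \in enum V -> exists2 x, x \in L v & c v = Some x.
  have: size (enum V) <= #|V| by rewrite -cardE.
  elim: (enum V) => [|v s IHs] /= s_le; first by exists (fun=> None).
  have [c c_inj cL] := IHs (ltnW s_le).
  have [vs|vNs] := boolP (v \in s).
    by exists c => [x y|x]; rewrite !inE => /predU1P[->|?];
      try (move=> /predU1P[->|?]); auto.
  pose used := [fset x in pmap c s]%fset.
  have [x xL xNused]: exists2 x, x \in L v & x \notin used.
    apply: contrapT => noX.
    have /fsubset_leq_card: (L v `<=` used)%fset.
      by apply/fsubsetP=> x xL; apply: contrapT => /negP xN; apply: noX; exists x.
    rewrite L_k leqNgt => /negP; apply; apply: leq_ltn_trans s_le.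
    rewrite card_fseq (leq_trans (size_undup _)) // size_pmap.
    by rewrite count_size // size_map.
  have fresh w : w \in s -> c w != Some x.
    move=> ws; apply: contra xNused => /eqP cw.
    by rewrite !inE mem_pmap -cw map_f.
  have sNv w : w \in s -> (w == v) = false.
    by move=> ws; apply: contraNF vNs => /eqP <-.
  exists (fun w => if w == v then Some x else c w) => [y z|y].
    rewrite !inE => /predU1P[->|ys] /predU1P[->|zs]; rewrite ?eqxx ?sNv //.
    - by move=> E; have := fresh z zs; rewrite -E eqxx.
    - by move=> E; have := fresh y ys; rewrite E eqxx.
    - exact: c_inj.
  rewrite inE => /predU1P[->|ys]; first by rewrite eqxx; exists x.
  by rewrite sNv //; apply: cL.
have /choice[d dP] v : exists x, x \in L v /\ c v = Some x.
  by have [|x ? ?] := cL v; rewrite ?mem_enum //; exists x.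
exists d => [|v]; last by case: (dP v).
apply: inj_proper => // u v duv; apply: c_inj; rewrite ?mem_enum //.
by rewrite (dP u).2 (dP v).2 duv.
Qed.

(* [K^r_(p_1, ..., p_k)] for the sequence [p = [:: p_1; ...; p_k]]: a vertex is
   a pair (part index i, element of 'I_(p_i)). *)
Definition multipartite_vertex (p : seq nat) : finType :=
  {i : 'I_(size p) & 'I_(nth 0 p i)}.

Definition part (p : seq nat) (i : 'I_(size p)) : {set multipartite_vertex p} :=
  [set v | tag v == i].

Definition complete_multipartite (r : nat) (p : seq nat) :
    {set {set multipartite_vertex p}} :=
  [set S : {set multipartite_vertex p} |
    (#|S| == r) && [forall i, ~~ (S \subset part i)]].

(* Main.v *)
(* The [mr] colors, with [k = m(r-1)], are split into [r] classes of size [m],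
   and the [t]-th vertex of each part gets all colors outside the class of
   [t mod r].  A color then misses a vertex of each part of size [r] and two
   vertices of the part of size [2r]; hence it is used at most [r-1] times,
   unless it occurs only in the big part, where it is used at most [2(r-1)]
   times.  Let [U] be the set of these exceptional colors.  The [(k+1)r]
   vertices give [(k+1)r <= kr + |U|(r-1)], and the [(k-1)r] vertices outside
   the big part give [(k-1)r <= kr - |U|(r-1)].  Thus [|U|(r-1) = r], which is
   impossible for [r >= 3]. *)
Require Import Defs.
From mathcomp Require Import all_boot.
From mathcomp Require Import finmap boolp zify.
Set Implicit Arguments.
Unset Strict Implicit.
Unset Printing Implicit Defensive.

Lemma sum_card_fibre (V C : finType) (c : V -> C) (A : {set V}) :
  \sum_x #|[set v in A | c v == x]| = #|A|.
Proof.
rewrite -sum1_card (partition_big c xpredT) //=; apply: eq_bigr => x _.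
by rewrite -sum1_card; apply: eq_bigl => v; rewrite inE.
Qed.

Lemma exists_set_between (V : finType) (A B : {set V}) (n : nat) :
  A \subset B -> #|A| <= n -> n <= #|B| ->
  exists T : {set V}, [/\ A \subset T, T \subset B & #|T| = n].
Proof.
move=> AB A_le le_B.
have /card_geqP[s [s_uniq s_size sP]] : n - #|A| <= #|B :\: A|.
  by rewrite cardsD (setIidPr AB) leq_sub2r.
exists (A :|: [set u in s]); split; first exact: subsetUl.
  rewrite subUset AB; apply/subsetP=> u; rewrite inE => /sP.
  by rewrite inE => /andP[].
rewrite cardsU cardsE (card_uniqP s_uniq) s_size (_ : _ :&: _ = set0).
  by rewrite cards0 subn0 subnKC.
apply/setP=> u; rewrite in_set0; apply/negbTE/negP => /setIP[uA].
by rewrite inE => /sP /setDP[_]; rewrite uA.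
Qed.

Lemma card_part (p : seq nat) (i : 'I_(size p)) : #|part i| = nth 0 p i.
Proof.
rewrite -[RHS]card_ord -cardsT.
have <- : [set Tagged (fun i : 'I_(size p) => 'I_(nth 0 p i)) j
    | j in [set: 'I_(nth 0 p i)]] = part i.
  apply/setP=> v; rewrite inE; apply/imsetP/eqP => [[j _ ->] //|].
  by case: v => i' j /= E; subst i'; exists j; rewrite ?inE.
by rewrite card_imset //; exact: eq_from_Tagged.
Qed.

Lemma card_multipartite_vertex (p : seq nat) :
  #|multipartite_vertex p| = sumn p.
Proof.
rewrite -cardsT -(sum_card_fibre (fun v : multipartite_vertex p => tag v)).
rewrite sumnE (big_nth 0) big_mkord; apply: eq_bigr => i _.
by rewrite -card_part; apply: eq_card => v; rewrite !inE.
Qed.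

(** Two vertices of the class in different parts would extend, inside the class, to an r-set, which
    is then a monochromatic edge. *)
Lemma proper_fibre_sub_part (r : nat) (p : seq nat) (C : eqType)
    (c : multipartite_vertex p -> C) (x : C) :
  2 <= r -> Defs.proper (complete_multipartite r p) c ->
  r <= #|[set v | c v == x]| -> exists i, [set v | c v == x] \subset part i.
Proof.
set S := [set v | _] => r_ge2 c_proper r_le.
have /card_gt0P[v vS] : 0 < #|S| by lia.
exists (tag v); apply/subsetP=> w wS; apply: contrapT => /negP wNv.
have vw : v != w by apply: contraNneq wNv => <-; rewrite inE.
have vwS : [set v; w] \subset S by rewrite subUset !sub1set vS wS.
have [|T [vwT T_sub T_r]] := exists_set_between vwS _ r_le; first by rewrite cards2 vw.
have T_edge : T \in complete_multipartite r p.
  rewrite inE T_r eqxx /=.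
  apply/forallP => i; apply/negP => /subsetP T_part.
  have [/T_part vi /T_part wi] : v \in T /\ w \in T.
    by split; apply: (subsetP vwT); rewrite !inE eqxx ?orbT.
  by move: vi wi wNv; rewrite !inE => /eqP-> /eqP->; rewrite eqxx.
have [a [b [/(subsetP T_sub) aS /(subsetP T_sub) bS]]] := c_proper T T_edge.
by move: aS bS; rewrite !inE => /eqP-> /eqP->; rewrite eqxx.
Qed.

Lemma colorable_multipartite (r : nat) (p : seq nat) :
  0 < r -> colorable (complete_multipartite r p) (size p).
Proof.
move=> r_gt0; exists (fun v => tag v) => e; rewrite inE => /andP[/eqP e_r /forallP eN].
have /card_gt0P[u ue] : 0 < #|e| by rewrite e_r.
have /subsetPn[v ve] := eN (tag u); rewrite inE eq_sym => uv.
by exists u, v.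
Qed.

(** Lists can be truncated. As the choice number is only a least value, this is what turns an upper
    bound on it into choosability at [k]. *)
Lemma choosable_leq (V : finType) (H : {set {set V}}) (m n : nat) :
  m <= n -> choosable H m -> choosable H n.
Proof.
move=> mn H_m C L L_n; pose L' v := [fset x in take m (L v)]%fset.
have L'_m : list_assignment m L'.
  move=> v; rewrite card_fseq undup_id ?take_uniq ?fset_uniq // size_takel //.
  by rewrite [size _]L_n.
have [c c_proper cL'] := H_m C L' L'_m; exists c => // v.
by have := cL' v; rewrite inE => /mem_take.
Qed.

Section BigPart.

Variables r k : nat.
Hypotheses (r_ge3 : 3 <= r) (k_gt0 : 0 < k).

Let p := 2 * r :: nseq (k - 1) r.
Local Notation V := (multipartite_vertex p).
Let K := complete_multipartite r p.
Let V0 : {set V} := part (ord0 : 'I_(size p)).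

Let vertex (i : 'I_(size p)) (t : 'I_(nth 0 p i)) : V :=
  Tagged (fun i : 'I_(size p) => 'I_(nth 0 p i)) t.

Let card_V0 : #|V0| = 2 * r.
Proof. by rewrite card_part. Qed.

Let card_V : #|V| = (k + 1) * r.
Proof. by rewrite card_multipartite_vertex /= sumn_nseq; nia. Qed.

Let card_V0C : #|~: V0| = (k - 1) * r.
Proof. by have := cardsC V0; rewrite card_V0 card_V; nia. Qed.

Let card_small_part (i : 'I_(size p)) : i != ord0 -> #|part i| = r.
Proof.
rewrite card_part; case: i => -[|i] lt_i //= _.
by rewrite nth_nseq; move: lt_i; rewrite /= size_nseq ltnS => ->.
Qed.

(* Vertices outside the big part have weight 2, the others weight 1: a color
   class then weighs at most [2r], and the total weight is [2kr]. *)
Lemma colorable_geq (n : nat) : colorable K n -> k <= n.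
Proof.
case=> c c_proper.
have : \sum_x (#|[set v in [set: V] | c v == x]| + #|[set v in ~: V0 | c v == x]|)
    <= \sum_(x < n) 2 * r.
  apply: leq_sum => x _.
  rewrite (_ : [set v in [set: V] | c v == x] = [set v | c v == x]); last first.
    by apply/setP=> v; rewrite !inE.
  have sub : [set v in ~: V0 | c v == x] \subset [set v | c v == x].
    by apply/subsetP=> v; rewrite !inE => /andP[].
  have le := subset_leq_card sub.
  (* Fewer than r vertices weigh less than 2r. A larger class lies in one part: a small part has r
     vertices of weight 2, the big one 2r vertices of weight 1. *)
  have [lt_r|r_le] := ltnP #|[set v | c v == x]| r; first by lia.
  have [i S_i] := proper_fibre_sub_part (ltnW r_ge3) c_proper r_le.
  have leS : #|[set v | c v == x]| <= #|part i| := subset_leq_card S_i.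
  have [i0|i_n0] := eqVneq i ord0; last by rewrite (card_small_part i_n0) in leS; lia.
  rewrite i0 -/V0 card_V0 in leS S_i.
  rewrite (_ : [set v in ~: V0 | c v == x] = set0) ?cards0; first by lia.
  apply/setP=> v; rewrite in_set0; apply/negbTE/negP => /setIdP[].
  rewrite in_setC => /negP vN cv; apply: vN.
  by apply: (subsetP S_i); rewrite inE.
rewrite big_split /= !sum_card_fibre cardsT card_V card_V0C sum_nat_const card_ord.
by nia.
Qed.

Lemma not_choosable_multiple (m : nat) : k = m * (r - 1) -> ~ choosable K k.
Proof.
move=> k_def; have r_gt0 : 0 < r by lia.
(* A color is a pair (class, index within the class), and [cls v] is the class withheld from [v];
   this leaves (r-1)m = k colors. *)
pose cls (v : V) : 'I_r := Ordinal (ltn_pmod (tagged v) r_gt0).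
pose L (v : V) : {fset 'I_r * 'I_m} :=
  [fset x in enum [set x : 'I_r * 'I_m | x.1 != cls v]]%fset.
have L_k : list_assignment k L.
  move=> v; rewrite card_fseq undup_id ?enum_uniq // -cardE.
  rewrite (_ : [set x | _] = setX [set~ cls v] [set: 'I_m]).
    by rewrite cardsX cardsT cardsC1 !card_ord k_def; lia.
  by apply/setP=> x; rewrite !inE andbT.
move=> /(_ _ L L_k)[c c_proper cL].
have c_cls v : (c v).1 != cls v by have := cL v; rewrite inE /= mem_enum inE.
pose all x := [set v in [set: V] | c v == x].
pose out x := [set v in ~: V0 | c v == x].
have allE x : all x = [set v | c v == x] by apply/setP=> v; rewrite !inE.
have out_sub x : #|out x| <= #|all x|.
  by apply: subset_leq_card; apply/subsetP=> v; rewrite !inE => /andP[].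
(* The exceptional colors are selected by their number of uses; that they occur only in the big part
   follows in [U_big]. *)
pose U := [set x | r <= #|all x|].
have U_big x : x \in U -> #|all x| <= 2 * (r - 1) /\ #|out x| = 0.
  rewrite inE allE => r_le.
  have [i S_i] := proper_fibre_sub_part (ltnW r_ge3) c_proper r_le.
  have missed (t : 'I_(nth 0 p i)) : t %% r = x.1 ->
      vertex t \notin [set v | c v == x].
    move=> tx; rewrite inE; set v := vertex t.
    by apply: contraNneq (c_cls v) => ->; apply/eqP/val_inj.
  have [i0|i_n0] := eqVneq i ord0; last first.
    (* In a small part the vertex of index [x.1] misses [x], so at most r-1 vertices are left,
       against [r_le]. *)
    have lt_x : x.1 < nth 0 p i by rewrite -card_part card_small_part.
    have missed_x := missed (Ordinal lt_x) (modn_small (ltn_ord x.1)).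
    suff : #|[set v | c v == x]| < #|part i| by rewrite card_small_part //; lia.
    apply: proper_card; apply/properP; split=> //.
    by exists (vertex (Ordinal lt_x)) => //; rewrite inE.
  have S_V0 : [set v | c v == x] \subset V0 by rewrite /V0 -i0.
  have nth_i : nth 0 p i = 2 * r by rewrite i0.
  have x_lt := ltn_ord x.1.
  split.
    (* The indices below 2r that are congruent to [x.1] modulo r are [x.1] and [x.1 + r]. *)
    have lt1 : x.1 < nth 0 p i by rewrite nth_i; lia.
    have lt2 : x.1 + r < nth 0 p i by rewrite nth_i; lia.
    pose v1 := vertex (Ordinal lt1 : 'I_(nth 0 p i)).
    pose v2 := vertex (Ordinal lt2 : 'I_(nth 0 p i)).
    have v12 : v1 != v2.
      by rewrite eq_Tagged; apply/eqP => /(congr1 val) /=; lia.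
    suff : [set v | c v == x] \subset V0 :\: [set v1; v2].
      move=> /subset_leq_card; rewrite cardsD (setIidPr _).
        by rewrite card_V0 cards2 v12; lia.
      by rewrite subUset !sub1set !inE /= i0.
    apply/subsetP=> v vS; rewrite in_setD (subsetP S_V0) // andbT.
    have v1N : v1 \notin [set v | c v == x].
      by apply: missed; rewrite /= modn_small.
    have v2N : v2 \notin [set v | c v == x].
      by apply: missed; rewrite /= modnDr modn_small.
    by apply/negP; rewrite !inE => /orP[] /eqP E; subst v; rewrite vS in v1N v2N.
  apply/eqP; rewrite cards_eq0; apply/eqP/setP=> v; rewrite in_set0.
  apply/negbTE/negP => /setIdP[]; rewrite in_setC => /negP vN cv; apply: vN.
  by apply: (subsetP S_V0); rewrite inE.
have card_C : #|{: 'I_r * 'I_m}| = r * m by rewrite card_prod !card_ord.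
(* The same correction r-1 on [U] serves both counts: it raises the bound on [all] to 2(r-1), and it
   fits beside [out], which is 0 there. *)
have all_le : \sum_x #|all x| <= \sum_x ((r - 1) + (if x \in U then r - 1 else 0)).
  apply: leq_sum => x _; have [/U_big[]|] := boolP (x \in U); first by lia.
  by rewrite inE; lia.
have out_le : \sum_x (#|out x| + (if x \in U then r - 1 else 0)) <=
    \sum_(x : 'I_r * 'I_m) (r - 1).
  apply: leq_sum => x _; have [/U_big[]|] := boolP (x \in U); first by lia.
  by have := out_sub x; rewrite inE; lia.
have U_sum : \sum_(x : 'I_r * 'I_m) (if x \in U then r - 1 else 0) =
    #|U| * (r - 1).
  by rewrite -big_mkcond sum_nat_const.
have all_sum : \sum_x #|all x| = (k + 1) * r.
  by rewrite sum_card_fibre cardsT card_V.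
have out_sum : \sum_x #|out x| = (k - 1) * r.
  by rewrite sum_card_fibre card_V0C.
rewrite !big_split /= ?all_sum ?out_sum U_sum sum_nat_const card_C in all_le out_le.
have rmk : r * m * (r - 1) = k * r by rewrite k_def; lia.
rewrite rmk in all_le out_le.
(* [all_le] gives one inequality and [out_le] the other. *)
have : #|U| * (r - 1) = r by nia.
(* The product is 0 or r-1 for [#|U|] at most 1, and from 2 on it is at least 2(r-1), which exceeds
   r because r >= 3. *)
by case: #|U| => [|[|n]]; nia.
Qed.

End BigPart.

Theorem theorem3p1 (r k : nat) (r_ge3 : 3 <= r) (k_gt0 : 0 < k)
    (k_mult : r - 1 %| k) :
  let K := complete_multipartite r (2 * r :: nseq (k - 1) r) in
  choice_number K > chromatic_number K /\ chromatic_number K = k.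
Proof.
move=> K.
have K_gt1 e : e \in K -> 1 < #|e|.
  by rewrite inE => /andP[/eqP-> _]; lia.
have K_k : colorable K k.
  have := @colorable_multipartite r (2 * r :: nseq (k - 1) r) (ltnW (ltnW r_ge3)).
  by rewrite /= size_nseq (_ : (k - 1).+1 = k) //; lia.
have [chi_col chi_min] := leastP (ex_intro _ k K_k).
have chi_k : chromatic_number K = k.
  by apply/eqP; rewrite eqn_leq chi_min //=; exact: (colorable_geq r_ge3 k_gt0 chi_col).
split; rewrite chi_k //.
(* [choosable_card] excludes the default value 0 of [least], so the choice number is attained. *)
have [ch_choosable _] := leastP (ex_intro _ _ (choosable_card K_gt1)).
rewrite ltnNge; apply/negP => le_k.
have /dvdnP[m k_def] := k_mult.
exact: (not_choosable_multiple r_ge3 k_gt0 k_def) (choosable_leq le_k ch_choosable).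
Qed.
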